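(* Let $(A_i,B_i)$, $1\le i\le m$, be pairs of nonzero subspaces of a finite-dimensional vector space over an arbitrary field. Set $a_i=\dim A_i$ and $b_i=\dim B_i$. If $$A_i\cap B_i=\{0\}\ \text{ for all } i,\qquad A_i\cap B_j\ne\{0\}\ \text{ for all } i\ne j,$$ then $$\sum_{i=1}^{m}\frac{1}{\binom{a_i+b_i}{a_i}}\le 1.$$
   Context: Here $m$ is any nonnegative integer (for $m=0$ the sum is empty). *)

(* Defs.v *)
From mathcomp Require Import all_boot all_order all_algebra.

Set Implicit Arguments.
Unset Strict Implicit.
Unset Printing Implicit Defensive.

(* Main.v *)
(**
Extend scalars to an infinite field and identify the space with K^n.  In the
exterior algebra of K^n let I be the ideal generated by the products w(B_i) of
bases of the B_i, with homogeneous components I_k.  Put S_i = A_i + B_i, with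
s_i = dim S_i and b_i = dim B_i.  Multiplication by w(A_i) kills w(B_j) for j <> i,
so the maps x |-> w(A_i) x send I onto the direct sum of the principal ideals
w(S_i).  This forces the growth estimate

  (k+1) dim I_(k+1) - (n-k) dim I_k >= sum_i b_i 'C(n - s_i, k + 1 - b_i),

the linear analogue of counting the elements that are pivotal for a set to
contain one of the B_i.  Telescoping dim I_k / 'C(n, k) from 0 (k = 0) to at most 1
(k = n) and summing the right-hand sides gives the theorem.

The growth estimate is proved by induction on n.  After a generic change of basis
the first basis vector e avoids every S_i <> K^n, and I splits into I' = I mod e
and I'' = { w | e w in I } inside the exterior algebra of K^(n-1); both again map
onto the sum of the ideals of the projected S_i, and I' <= I''.  As soon as
S_i = K^n, the index i only contributes one generator of I, which is why the
estimate is strengthened by the number of new generators that the remaining maps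
do not detect.
*)
Require Import Defs.
From HB Require Import structures.
From mathcomp Require Import all_boot all_order all_algebra.
From mathcomp Require Import zify ring.

Set Implicit Arguments.
Unset Strict Implicit.
Unset Printing Implicit Defensive.

Import Order.TTheory GRing.Theory Num.Theory.
Local Open Scope ring_scope.

(** * The exterior algebra and its creation and annihilation operators *)

Section ExteriorAlgebra.
Variable K : fieldType.

(* The exterior algebra E_n of K^n is the space of row vectors of length edim n = 2^n,
   with E_(n+1) = E_n + e E_n for the first basis vector e; operators act on the
   right.  wedge v is the exterior product by v on the left, contr f the contraction
   by the linear form f. *)
Fixpoint edim (n : nat) : nat := if n is n'.+1 then (edim n' + edim n')%N else 1%N.

Fixpoint wedge n : 'rV[K]_n -> 'M[K]_(edim n) :=
  match n return 'rV[K]_n -> 'M[K]_(edim n) with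
  | 0 => fun=> 0
  | n'.+1 => fun v : 'rV[K]_(1 + n') =>
      block_mx (wedge (rsubmx v)) (lsubmx v 0 0)%:M 0 (- wedge (rsubmx v))
  end.

Fixpoint contr n : 'cV[K]_n -> 'M[K]_(edim n) :=
  match n return 'cV[K]_n -> 'M[K]_(edim n) with
  | 0 => fun=> 0
  | n'.+1 => fun f : 'cV[K]_(1 + n') =>
      block_mx (contr (dsubmx f)) 0 (usubmx f 0 0)%:M (- contr (dsubmx f))
  end.

(* The projection onto the homogeneous component of degree k. *)
Fixpoint grade n : nat -> 'M[K]_(edim n) :=
  match n return nat -> 'M[K]_(edim n) with
  | 0 => fun k => (k == 0)%:R%:M
  | n'.+1 => fun k =>
      block_mx (grade n' k) 0 0 (if k is k'.+1 then grade n' k' else 0)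
  end.

Lemma wedge_is_linear n : linear (@wedge n).
Proof.
elim: n => [|n IHn] a u v /=; first by rewrite scaler0 addr0.
rewrite scale_block_mx add_block_mx !linearP /= IHn scaler0 addr0 scalerN opprD.
congr block_mx; rewrite !mxE scale_scalar_mx -raddfD.
by congr (_%:M).
Qed.

HB.instance Definition _ n :=
  GRing.isLinear.Build K 'rV[K]_n 'M[K]_(edim n) *:%R (@wedge n) (@wedge_is_linear n).

Lemma wedge_sq n (v : 'rV[K]_n) : wedge v *m wedge v = 0.
Proof.
elim: n v => [|n IHn] v /=; first by rewrite mulmx0.
rewrite mulmx_block !mulmxN !mulNmx opprK IHn !mul0mx !mulmx0.
by rewrite mul_scalar_mx mul_mx_scalar !addr0 add0r oppr0 subrr block_mx0.
Qed.

Lemma wedge_anticomm n (u v : 'rV[K]_n) : wedge u *m wedge v = - (wedge v *m wedge u).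
Proof.
apply/eqP; rewrite -addr_eq0; apply/eqP.
have := wedge_sq (u + v).
rewrite raddfD /= mulmxDl !mulmxDr !wedge_sq.
by rewrite add0r addr0.
Qed.

(** When [v *m f] is 1 this decomposes the identity operator, which is how a contraction is used to
    undo a multiplication by [v]. *)
Lemma wedge_contr n (v : 'rV[K]_n) (f : 'cV[K]_n) :
  wedge v *m contr f + contr f *m wedge v = ((v *m f) 0 0)%:M.
Proof.
elim: n v f => [|n IHn] v f /=.
  rewrite thinmx0 !mul0mx. by rewrite mxE addr0 raddf0.
rewrite -[in RHS](hsubmxK (v : 'rV_(1 + n))) -[in RHS](vsubmxK (f : 'cV_(1 + n))).
rewrite (@mul_row_col _ 1 1 n 1) [in RHS]mxE.
set v' := rsubmx _; set f' := dsubmx _.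
rewrite !mulmx_block add_block_mx !mulmx0 !mul0mx !mulmxN !mulNmx !opprK.
rewrite !mul_scalar_mx !mul_mx_scalar !add0r !addr0 !addNr.
have -> : (lsubmx (v : 'rV_(1 + n)) *m usubmx (f : 'cV_(1 + n))) 0 0
   = lsubmx (v : 'rV_(1 + n)) 0 0 * usubmx (f : 'cV_(1 + n)) 0 0.
  by rewrite mxE big_ord1.
have scalarD a b : (a + b)%:M = a%:M + b%:M :> 'M[K]_(edim n + edim n) by exact: raddfD.
rewrite [RHS]scalarD !scalar_mx_block -IHn !scale_scalar_mx (mulrC (usubmx _ _ _)).
rewrite add_block_mx !addr0.
by congr block_mx; [rewrite -addrA|]; exact: addrCA.
Qed.

Definition wedges n (vs : seq 'rV[K]_n) : 'M[K]_(edim n) :=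
  foldr (fun v M => wedge v *m M) 1%:M vs.

Lemma wedges_cat n (us vs : seq 'rV[K]_n) :
  wedges (us ++ vs) = wedges us *m wedges vs.
Proof. by elim: us => [|u us IH] /=; rewrite ?mul1mx // IH mulmxA. Qed.

Lemma wedge_wedges n (v : 'rV[K]_n) vs :
  wedge v *m wedges vs = (-1) ^+ size vs *: (wedges vs *m wedge v).
Proof.
elim: vs => [|u vs IH] /=; first by rewrite expr0 scale1r mulmx1 mul1mx.
rewrite mulmxA wedge_anticomm mulNmx -(mulmxA _ (wedge v)) IH -scalemxAr.
by rewrite exprS mulN1r scaleNr mulmxA.
Qed.

Lemma contr_wedges n (f : 'cV[K]_n) vs :
    (forall v, v \in vs -> v *m f = 0) ->
  contr f *m wedges vs = (-1) ^+ size vs *: (wedges vs *m contr f).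
Proof.
elim: vs => [|u vs IH] vs0 /=; first by rewrite expr0 scale1r mulmx1 mul1mx.
have /eqP := wedge_contr u f.
rewrite vs0 ?mem_head // mxE raddf0 addrC addr_eq0 => /eqP uf.
rewrite mulmxA uf mulNmx -(mulmxA _ (contr f)) IH; last first.
  by move=> v vvs; apply: vs0; rewrite inE vvs orbT.
by rewrite -scalemxAr mulmxA exprS mulN1r scaleNr.
Qed.

Lemma wedges_sum_span n (v : 'rV[K]_n) vs :
  (v <= \sum_(u <- vs) <<u>>)%MS -> wedges vs *m wedge v = 0.
Proof.
elim: vs v => [|u vs IH] v /=.
  by rewrite big_nil submx0 => /eqP->; rewrite raddf0 mulmx0.
rewrite big_cons => /sub_addsmxP[[a b] /= ->].
set x := a *m _; set y := b *m _; rewrite raddfD /= mulmxDr.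
have -> : wedge u *m wedges vs *m wedge y = 0.
  by rewrite -mulmxA IH ?mulmx0 // submxMl.
have /sub_rVP[c ->] : (x <= u)%MS by rewrite -(genmxE u) submxMl.
rewrite addr0 linearZ /= -scalemxAr.
suff -> : wedges (u :: vs) *m wedge u = 0 by rewrite scaler0.
have /eqP : wedge u *m wedges (u :: vs) = 0 by rewrite /= mulmxA wedge_sq mul0mx.
by rewrite wedge_wedges scaler_eq0 signr_eq0 => /eqP.
Qed.

Lemma wedge_grade0 n (v : 'rV[K]_n) : wedge v *m grade n 0 = 0.
Proof.
elim: n v => [|n IHn] v /=; first by rewrite mul0mx.
by rewrite mulmx_block !mulmx0 !mul0mx !addr0 IHn block_mx0.
Qed.

Lemma grade0_contr n (f : 'cV[K]_n) : grade n 0 *m contr f = 0.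
Proof.
elim: n f => [|n IHn] f /=; first by rewrite mulmx0.
by rewrite mulmx_block !mulmx0 !mul0mx !addr0 IHn block_mx0.
Qed.

Lemma grade_wedge n k (v : 'rV[K]_n) : grade n k *m wedge v = wedge v *m grade n k.+1.
Proof.
elim: n k v => [|n IHn] k v /=; first by rewrite mulmx0 mul0mx.
rewrite !mulmx_block !mulmx0 !mul0mx !addr0 !add0r IHn mul_mx_scalar mul_scalar_mx.
case: k => [|k]; last by rewrite mulNmx mulmxN IHn.
by rewrite mul0mx mulNmx wedge_grade0 oppr0.
Qed.

Lemma grade_contr n k (f : 'cV[K]_n) : grade n k.+1 *m contr f = contr f *m grade n k.
Proof.
elim: n k f => [|n IHn] k f /=; first by rewrite mulmx0 mul0mx.
rewrite !mulmx_block !mulmx0 !mul0mx !addr0 !add0r IHn mul_mx_scalar mul_scalar_mx.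
case: k => [|k]; last by rewrite mulNmx mulmxN IHn.
by rewrite mulmx0 mulmxN grade0_contr oppr0.
Qed.

Lemma grade_wedges n k (vs : seq 'rV[K]_n) :
  grade n k *m wedges vs = wedges vs *m grade n (k + size vs).
Proof.
elim: vs k => [|v vs IH] k /=; first by rewrite mulmx1 mul1mx addn0.
by rewrite mulmxA grade_wedge -mulmxA IH mulmxA addSnnS.
Qed.

Lemma rank_grade_top n k : (n <= k)%N -> (\rank (grade n k) <= (n == k))%N.
Proof.
elim: n k => [|n IHn] k /=.
  by case: k => [|k] _ /=; rewrite ?rank_leq_row // raddf0 mxrank0.
case: k => // k lenk; rewrite rank_diag_block_mx eqSS.
have -> : \rank (grade n k.+1) = 0%N.
  apply/eqP; rewrite -leqn0; apply: leq_trans (IHn _ (leqW lenk)) _.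
  by rewrite ltn_eqF.
exact: IHn.
Qed.

(** * Functionals, spans and nonvanishing of products *)

Lemma functional_notin n r (v : 'rV[K]_n) (U : 'M[K]_(r, n)) :
  ~~ (v <= U)%MS -> exists2 f : 'cV[K]_n, U *m f = 0 & (v *m f) 0 0 = 1.
Proof.
have := mulmx_coker U; rewrite submxE; move: (cokermx U) => C UC /rV0Pn[j vj].
exists (((v *m C) 0 j)^-1 *: col j C).
  by rewrite -scalemxAr colE mulmxA UC mul0mx scaler0.
by rewrite -scalemxAr colE mulmxA -colE mxE [col _ _ _ _]mxE mulVf.
Qed.

Definition spanmx n (vs : seq 'rV[K]_n) : 'M[K]_n := (\sum_(u <- vs) <<u>>)%MS.

Lemma spanmx_cons n (v : 'rV[K]_n) vs : spanmx (v :: vs) = (<<v>> + spanmx vs)%MS.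
Proof. exact: big_cons. Qed.

Lemma spanmx_sup n (v : 'rV[K]_n) vs : v \in vs -> (v <= spanmx vs)%MS.
Proof.
elim: vs => // u vs IH; rewrite inE spanmx_cons => /predU1P[->|/IH vvs].
  by apply: submx_trans (addsmxSl _ _); rewrite genmxE.
exact: submx_trans vvs (addsmxSr _ _).
Qed.

Lemma spanmx_sub n r (vs : seq 'rV[K]_n) (U : 'M[K]_(r, n)) :
  {in vs, forall v, (v <= U)%MS} -> (spanmx vs <= U)%MS.
Proof.
elim: vs => [|u vs IH] vsU; first by rewrite /spanmx big_nil sub0mx.
rewrite spanmx_cons addsmx_sub genmxE vsU ?mem_head //=.
by apply: IH => v vvs; apply: vsU; rewrite inE vvs orbT.
Qed.

(** Multiplication by a vector preserves the ideal of [e], hence is block triangular. Only the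
    diagonal blocks act on [high] and [low], so [Z] stays unspecified. *)
Lemma wedges_split n (vs : seq 'rV[K]_n.+1) : exists Z, wedges vs =
  let vs' := [seq rsubmx (v : 'rV_(1 + n)) | v <- vs] in
  block_mx (wedges vs') Z 0 ((-1) ^+ size vs *: wedges vs').
Proof.
elim: vs => [|v vs [Z IH]] /=.
  by exists 0; rewrite expr0 scale1r -scalar_mx_block.
rewrite IH mulmx_block !mulmx0 !mul0mx !addr0 add0r; eexists; congr block_mx.
by rewrite exprS mulN1r scaleNr mulNmx scalemxAr.
Qed.

Lemma rank_spanmx n (vs : seq 'rV[K]_n) : (\rank (spanmx vs) <= size vs)%N.
Proof.
elim: vs => [|v vs IH]; first by rewrite /spanmx big_nil mxrank0.
rewrite spanmx_cons; apply: leq_trans (mxrank_adds_leqif _ _).1 _.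
by rewrite /= -[(size vs).+1]add1n mxrank_gen leq_add // rank_leq_row.
Qed.

Lemma rank_spanmx_cons n (v : 'rV[K]_n) vs : \rank (spanmx (v :: vs)) = (size vs).+1 ->
  \rank (spanmx vs) = size vs /\ ~~ (v <= spanmx vs)%MS.
Proof.
rewrite spanmx_cons => rkvs; split.
  apply/eqP; rewrite eqn_leq rank_spanmx -ltnS -rkvs.
  apply: leq_trans (mxrank_adds_leqif _ _).1 _.
  by rewrite -[(\rank (spanmx vs)).+1]add1n mxrank_gen leq_add // rank_leq_row.
apply/negP; rewrite -(genmxE v) => /addsmx_idPr v_vs.
by have := rank_spanmx vs; rewrite -v_vs rkvs ltnn.
Qed.

Lemma grade0_neq0 n : grade n 0 != 0.
Proof.
elim: n => [|n IHn] /=.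
  by apply/eqP => /matrixP/(_ 0 0)/eqP; rewrite !mxE oner_eq0.
by apply: contraNneq IHn => /eqP; rewrite -block_mx0 => /eqP/eq_block_mx[-> _ _ _].
Qed.

(** Contracting by a functional that is 1 on the first vector and 0 on the others removes the first
    factor, so a vanishing product would force the shorter one to vanish. *)
Lemma grade0_wedges_neq0 n (vs : seq 'rV[K]_n) :
  \rank (spanmx vs) = size vs -> grade n 0 *m wedges vs != 0.
Proof.
elim: vs => [_|v vs IH] /=; first by rewrite mulmx1 grade0_neq0.
case/rank_spanmx_cons=> /IH gvs_neq0 /functional_notin[f vsf vf].
apply: contraNneq gvs_neq0; rewrite wedge_wedges => /eqP.
rewrite -scalemxAr scaler_eq0 signr_eq0 /= mulmxA => /eqP gvs0.
rewrite -[_ *m wedges vs]mulmx1 -[1%:M]/(1%:M : 'M_(edim n)) -vf -wedge_contr.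
rewrite mulmxDr !mulmxA gvs0 mul0mx add0r -(mulmxA (grade n 0)).
have -> : wedges vs *m contr f = (-1) ^+ size vs *: (contr f *m wedges vs).
  rewrite contr_wedges ?scalerA -?expr2 ?sqrr_sign ?scale1r //.
  by move=> u uvs; have := submxMr f (spanmx_sup uvs); rewrite vsf => /submx0null.
by rewrite -scalemxAr mulmxA grade0_contr !mul0mx scaler0 mul0mx.
Qed.

End ExteriorAlgebra.

(** * Splitting off the first basis vector *)

Section HighLow.
Variable K : fieldType.

(* With x + e y written as row_mx x y, high X is X mod e and low X is { y | e y in X }. *)
Definition high p r (X : 'M[K]_(r, p + p)) : 'M[K]_p := <<lsubmx X>>%MS.
Definition low p r (X : 'M[K]_(r, p + p)) : 'M[K]_p :=
  <<kermx (lsubmx X) *m rsubmx X>>%MS.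

Lemma sub_low p r q (w : 'M[K]_(q, p)) (X : 'M[K]_(r, p + p)) :
  (w <= low X)%MS = (row_mx 0 w <= X)%MS.
Proof.
rewrite genmxE; apply/idP/idP => [/submxP[y ->]|/submxP[y]].
  apply/submxP; exists (y *m kermx (lsubmx X)).
  have := mulmx_ker (lsubmx X); move: (kermx _) => Z Z0.
  by rewrite -{2}(hsubmxK X) mul_mx_row -!mulmxA Z0 mulmx0.
rewrite -{1}(hsubmxK X) mul_mx_row => /eq_row_mx[/esym/eqP y0 ->].
by apply: submxMr; apply/sub_kermxP/eqP.
Qed.

Lemma row0_low p r (X : 'M[K]_(r, p + p)) : (row_mx 0 (low X) <= X)%MS.
Proof. by rewrite -sub_low. Qed.

Lemma lowS p r1 r2 (X : 'M[K]_(r1, p + p)) (Y : 'M_(r2, p + p)) :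
  (X <= Y)%MS -> (low X <= low Y)%MS.
Proof. by move=> XY; rewrite sub_low (submx_trans (row0_low X)). Qed.

Lemma highS p r1 r2 (X : 'M[K]_(r1, p + p)) (Y : 'M_(r2, p + p)) :
  (X <= Y)%MS -> (high X <= high Y)%MS.
Proof.
by case/submxP=> y ->; rewrite !genmxE -{1}(hsubmxK Y) mul_mx_row row_mxKl submxMl.
Qed.

(** Reduction modulo [e] maps [X] onto [high X], and its kernel on [X] is [e] times [low X]. *)
Lemma mxrank_high_low p r (X : 'M[K]_(r, p + p)) :
  \rank X = (\rank (high X) + \rank (low X))%N.
Proof.
pose B : 'M[K]_(p + p, p) := col_mx 1%:M 0.
have mulB q (Y : 'M_(q, p + p)) : Y *m B = lsubmx Y.
  by rewrite -{1}(hsubmxK Y) mul_row_col mulmx1 mulmx0 addr0.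
pose E : 'M[K]_(p, p + p) := row_mx 0 1%:M.
have mulE q (Y : 'M_(q, p)) : row_mx 0 Y = Y *m E by rewrite mul_mx_row mulmx0 mulmx1.
have rk0 (Y : 'M[K]_p) : \rank (row_mx 0 Y : 'M_(p, p + p)) = \rank Y.
  apply/eqP; rewrite eqn_leq; apply/andP; split; first by rewrite mulE mxrankM_maxl.
  have {1}-> : Y = row_mx (0 : 'M_(p, p)) Y *m col_mx 0 1%:M.
    by rewrite mul_row_col mulmx0 mulmx1 add0r.
  exact: mxrankM_maxl.
rewrite -(mxrank_mul_ker X B) mulB [in RHS]mxrank_gen -(rk0 (low X)); congr addn.
apply: eqmx_rank; apply/andP; split.
  set U := (X :&: kermx B)%MS.
  have U0 : lsubmx U = 0 by rewrite -mulB; apply/sub_kermxP/capmxSr.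
  by rewrite -(hsubmxK U) U0 !mulE; apply: submxMr; rewrite sub_low -U0 hsubmxK capmxSl.
by rewrite sub_capmx row0_low sub_kermx mulB row_mxKl eqxx.
Qed.

Lemma high_mul_ut p r (X : 'M[K]_(r, p + p)) (P Q R : 'M_p) :
  (high (X *m block_mx P Q 0 R) :=: high X *m P)%MS.
Proof.
apply: eqmx_trans (genmxE _) _; apply: eqmx_trans (eqmx_sym (eqmxMr _ (genmxE _))).
by rewrite -{1}(hsubmxK X) mul_row_block row_mxKl mulmx0 addr0; apply: eqmx_refl.
Qed.

Lemma low_mul_ut p r (X : 'M[K]_(r, p + p)) (P Q R : 'M_p) :
  (low X *m R <= low (X *m block_mx P Q 0 R))%MS.
Proof.
rewrite sub_low.
have -> : row_mx 0 (low X *m R) = row_mx 0 (low X) *m block_mx P Q 0 R.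
  by rewrite mul_row_block !mul0mx mulmx0 addr0 add0r.
exact: submxMr (row0_low X).
Qed.

(** In subtraction-free form: the image of [J] in the quotient by the larger space [L] is no bigger
    than in the quotient by [H]. *)
Lemma mxrank_adds_mono p r1 r2 r3 (J : 'M[K]_(r1, p)) (H : 'M_(r2, p)) (L : 'M_(r3, p)) :
  (H <= L)%MS -> (\rank (J + L)%MS + \rank H <= \rank (J + H)%MS + \rank L)%N.
Proof.
move=> HL; rewrite -(mxrank_sum_cap (J + H)%MS L) leq_add //.
  by apply: mxrankS; rewrite addsmx_sub -addsmxA addsmxSl (submx_trans (addsmxSr H L)) ?addsmxSr.
by apply: mxrankS; rewrite sub_capmx addsmxSr.
Qed.

End HighLow.

(** * The growth estimate *)

Section Growth.
Variable K : fieldType.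

(* M behaves like the ideal of a subspace of codimension c in general position with
   respect to the standard flag, generated in degree b after a shift; see
   cofree_shifted_ideal. *)
Fixpoint cofree (c : nat) : forall n, nat -> (nat -> 'M[K]_(edim n)) -> Prop :=
  match c return forall n, nat -> (nat -> 'M[K]_(edim n)) -> Prop with
  | 0 => fun n b M => (forall k (v : 'rV[K]_n), M k *m wedge v = 0) /\ M b != 0
  | c'.+1 => fun n b => match n return (nat -> 'M[K]_(edim n)) -> Prop with
    | 0 => fun=> False
    | n'.+1 => fun M => cofree c' b (fun k => high (M k : 'M_(edim n' + edim n'))) /\
        (forall k, low (M k.+1 : 'M_(edim n' + edim n')) <=
                   high (M k : 'M_(edim n' + edim n')))%MS
    end
  end.

(** For an ideal [I], [vmul (I k)] is the part of [I k.+1] that comes from degree [k]; new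
    generators are counted modulo it. *)
Definition vmul n (X : 'M[K]_(edim n)) : 'M[K]_(edim n) :=
  (\sum_(j < n) X *m wedge (delta_mx 0 j))%MS.

Lemma vmul_sup n (X : 'M[K]_(edim n)) v : (X *m wedge v <= vmul X)%MS.
Proof.
rewrite [v]row_sum_delta raddf_sum /= mulmx_sumr; apply: summx_sub => j _.
rewrite linearZ /= -scalemxAr scalemx_sub //.
exact: (sumsmx_sup j).
Qed.

Lemma vmul_sub n r (X : 'M[K]_(edim n)) (Y : 'M_(r, edim n)) :
  (forall v, (X *m wedge v <= Y)%MS) -> (vmul X <= Y)%MS.
Proof. by move=> XY; apply/sumsmx_subP => j _. Qed.

Variable T : finType.

(* The maps wedges (A i), i in G, send I onto the direct sum of the M i. *)
Definition resolved n (I : nat -> 'M[K]_(edim n)) (G : {set T}) (A : T -> seq 'rV[K]_n)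
    (M : T -> nat -> 'M[K]_(edim n)) (b c : T -> nat) : Prop :=
  [/\ (forall k v, (I k *m wedge v <= I k.+1)%MS) /\ (forall k, (I k <= grade K n k)%MS),
      forall i k, i \in G -> (I k *m wedges (A i) <= M i k)%MS,
      forall i k, i \in G -> exists W : 'M_(edim n),
        [/\ (W <= I k)%MS, (M i k <= W *m wedges (A i))%MS
          & {in G, forall j, j != i -> W *m wedges (A j) = 0}]
    & {in G, forall i, cofree (c i) (b i) (M i)}].

(* Unlike 'C(c, k - b), this vanishes for k < b. *)
Definition codeg c k b := if (b <= k)%N then 'C(c, k - b) else 0%N.

Definition tail n (vs : seq 'rV[K]_n.+1) := [seq rsubmx (v : 'rV_(1 + n)) | v <- vs].

Lemma vmul_high n (X : 'M[K]_(edim n.+1)) (Y : 'M[K]_(edim n + edim n)) :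
  (vmul X <= Y)%MS -> (vmul (high (X : 'M_(edim n + edim n))) <= high Y)%MS.
Proof.
move=> XY; apply: vmul_sub => v.
have := submx_trans (vmul_sup X (row_mx 0 v : 'rV_(1 + n))) XY.
rewrite /= row_mxKr => /highS; apply: submx_trans.
by rewrite high_mul_ut.
Qed.

Lemma vmul_low n (X : 'M[K]_(edim n.+1)) (Y : 'M[K]_(edim n + edim n)) :
  (vmul X <= Y)%MS -> (vmul (low (X : 'M_(edim n + edim n))) <= low Y)%MS.
Proof.
move=> XY; apply: vmul_sub => v.
have := submx_trans (vmul_sup X (row_mx 0 v : 'rV_(1 + n))) XY.
rewrite /= row_mxKr => /lowS; apply: submx_trans.
by apply: submx_trans (low_mul_ut _ _ _ _); rewrite mulmxN eqmx_opp.
Qed.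

(** Multiplying [x + e y] by [e] gives [e x]. *)
Lemma high_low_vmul n (X : 'M[K]_(edim n.+1)) (Y : 'M[K]_(edim n + edim n)) :
  (vmul X <= Y)%MS -> (high (X : 'M_(edim n + edim n)) <= low Y)%MS.
Proof.
move=> XY; rewrite sub_low.
have := submx_trans (vmul_sup X (row_mx 1%:M 0 : 'rV_(1 + n))) XY.
rewrite /= row_mxKr row_mxKl raddf0 /= oppr0 mxE eqxx mulr1n; apply: submx_trans.
have hX : (high (X : 'M_(edim n + edim n)) <= lsubmx (X : 'M_(edim n + edim n)))%MS.
  by rewrite genmxE.
have /submxP[y ->] := hX.
apply/submxP; exists y; rewrite -{2}(hsubmxK (X : 'M_(edim n + edim n))).
by rewrite mul_row_block !mulmx0 mulmx1 !addr0 mul_mx_row mulmx0.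
Qed.

Lemma sub_diag_block p r (X : 'M[K]_(r, p + p)) (P Q : 'M_p) :
  (X <= block_mx P 0 0 Q)%MS -> (high X <= P)%MS /\ (low X <= Q)%MS.
Proof.
move=> XPQ; split.
  have /submxP[y ->] := XPQ; rewrite genmxE -[y]hsubmxK mul_row_block !mulmx0.
  by rewrite addr0 row_mxKl submxMl.
have /submxP[y] := submx_trans (row0_low X) XPQ.
rewrite -[y]hsubmxK mul_row_block !mulmx0 addr0 add0r => /eq_row_mx[_ ->].
exact: submxMl.
Qed.

Lemma high_adds p r1 r2 (X : 'M[K]_(r1, p + p)) (Y : 'M[K]_(r2, p + p)) :
  (high (X + Y)%MS <= high X + high Y)%MS.
Proof.
have /sub_addsmxP[[x y] /= ->] := submx_refl (X + Y)%MS.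
rewrite genmxE -{1}(hsubmxK X) -{1}(hsubmxK Y) !mul_mx_row add_row_mx row_mxKl.
by apply: addmx_sub_adds; apply: mulmx_sub; rewrite genmxE.
Qed.

Lemma high_wedges n (X : 'M[K]_(edim n.+1)) vs :
  (high (X *m wedges vs : 'M_(edim n + edim n)) :=:
     high (X : 'M_(edim n + edim n)) *m wedges (tail vs))%MS.
Proof. by have [Z ->] := wedges_split vs; apply: high_mul_ut. Qed.

Lemma low_wedges n (X : 'M[K]_(edim n.+1)) vs :
  (low (X : 'M_(edim n + edim n)) *m wedges (tail vs)
    <= low (X *m wedges vs : 'M_(edim n + edim n)))%MS.
Proof.
have [Z ->] := wedges_split vs; apply: submx_trans (low_mul_ut _ _ _ _).
by rewrite -scalemxAr eqmx_scale // signr_eq0.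
Qed.

(** * Passing from an ideal to its two halves I' and I'' *)

Section Step.
Variables (n : nat) (I : nat -> 'M[K]_(edim n + edim n)) (G : {set T}).
Variables (A : T -> seq 'rV[K]_n.+1) (M : T -> nat -> 'M[K]_(edim n + edim n)).
Variables (b c : T -> nat).
Hypothesis IG : @resolved n.+1 I G A M b c.
Hypothesis c_gt0 : {in G, forall i, (0 < c i)%N}.

Lemma cofree_high i : i \in G -> cofree (c i).-1 (b i) (fun k => high (M i k)) /\
  forall k, (low (M i k.+1) <= high (M i k))%MS.
Proof.
case: IG => _ _ _ IF iG; have := IF i iG; have := c_gt0 iG.
by case: (c i).
Qed.

Lemma resolved_high : @resolved n (fun k => high (I k)) G (fun i => tail (A i))
  (fun i k => high (M i k)) b (fun i => (c i).-1).
Proof.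
case: (IG) => [[I_ideal I_gr] I_M I_W _]; split=> [|i k iG|i k iG|i /cofree_high[]//].
- split=> [k v|k]; last by have [] := sub_diag_block (I_gr k).
  have := highS (I_ideal k (row_mx 0 v : 'rV_(1 + n))).
  by rewrite /= row_mxKr; apply: submx_trans; rewrite high_mul_ut.
- by have := highS (I_M i k iG); rewrite high_wedges.
have [W [WI MW W0]] := I_W i k iG.
exists (high (W : 'M_(edim n + edim n))); split; first exact: highS.
  by have := highS MW; rewrite high_wedges.
move=> j jG ji; apply/eqP; rewrite -submx0.
by rewrite -high_wedges W0 // genmxE linear0 sub0mx.
Qed.

Lemma high_sub_low k : (high (I k) <= low (I k.+1))%MS.
Proof. by case: (IG) => [[I_ideal _] _ _ _]; apply: (@high_low_vmul n); apply: vmul_sub. Qed.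

(** The index shift gives [y] its own degree in [e y]. The targets are those of I': the second
    clause of [cofree] bounds the images, and the lifts are inherited from I' because I' lies in
    I''. *)
Lemma resolved_low : @resolved n (fun k => low (I k.+1)) G (fun i => tail (A i))
  (fun i k => high (M i k)) b (fun i => (c i).-1).
Proof.
case: (IG) => [[I_ideal I_gr] I_M _ _]; case: resolved_high => _ _ hI_W hF.
split=> [|i k iG|i k iG|//].
- split=> [k v|k]; last by have [] := sub_diag_block (I_gr k.+1).
  have := lowS (I_ideal k.+1 (row_mx 0 v : 'rV_(1 + n))).
  rewrite /= row_mxKr; apply: submx_trans.
  by apply: submx_trans (low_mul_ut _ _ _ _); rewrite mulmxN eqmx_opp.
- apply: submx_trans (low_wedges _ _) _.
  by apply: submx_trans (lowS (I_M i k.+1 iG)) _; case: (cofree_high iG).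
have [W [WI MW W0]] := hI_W i k iG.
by exists W; split=> //; apply: submx_trans WI (high_sub_low k).
Qed.

(** Modulo I', every element of I'' can be made invisible to all the maps, because I' alone already
    surjects onto the direct sum of the targets. *)
Lemma low_sub_killed k : exists2 J : 'M[K]_(edim n),
  (low (I k.+1) <= J + high (I k))%MS &
  (J <= low (I k.+1))%MS /\ {in G, forall i, J *m wedges (tail (A i)) = 0}.
Proof.
case: resolved_high => _ _ hI_W _; case: resolved_low => _ lI_M _ _.
set X := low _; set Y := high _.
have exZ i : exists Z : 'M_(edim n), i \in G -> [/\ (Z <= Y)%MS,
    X *m wedges (tail (A i)) = Z *m wedges (tail (A i))
    & {in G, forall j, j != i -> Z *m wedges (tail (A j)) = 0}].
  case iG: (i \in G); last by exists 0.
  have [W [WY MW W0]] := hI_W i k iG.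
  have /submxP[y yW] := submx_trans (lI_M i k iG) MW.
  exists (y *m W) => _; rewrite mulmxA in yW; split=> // [|j jG ji].
    exact: submx_trans (submxMl _ _) WY.
  by rewrite -mulmxA W0 // mulmx0.
have [Z ZP] := fin_all_exists exZ.
(* [Z i] has the same image as [X] under the map of index [i] and image 0 under the others, so
   subtracting the sum clears all images at once. *)
pose y := \sum_(i in G) Z i.
have yY : (y <= Y)%MS by apply: summx_sub => i /ZP[].
exists (X - y).
  by rewrite -{1}(subrK y X) addmx_sub_adds.
split; first by rewrite addmx_sub // eqmx_opp (submx_trans yY) // high_sub_low.
move=> i iG; rewrite mulmxBl mulmx_suml (bigD1 i) //= big1 ?addr0.
  by case: (ZP i iG) => _ -> _; rewrite subrr.
by move=> j /andP[jG ji]; case: (ZP j jG) => _ _ -> //; rewrite eq_sym.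
Qed.

End Step.

(** * Removal of indices of codimension zero, and the induction *)

Lemma codegS c k b : codeg c.+1 k.+1 b = (codeg c k.+1 b + codeg c k b)%N.
Proof.
rewrite /codeg; case: (leqP b k) => [bk|kb].
  by rewrite leqW // subSn // binS.
by rewrite leq_eqVlt ltnS leqNgt kb orbF; case: eqP => // ->; rewrite subnn !bin0.
Qed.

Lemma resolved_setD1 n (I : nat -> 'M[K]_(edim n)) G A M b c i :
  resolved I G A M b c -> resolved I (G :\ i) A M b c.
Proof.
case=> I_ideal I_M I_W IF; split=> // [j k|j k|j]; rewrite ?inE => /andP[_].
- exact: I_M.
- move=> /I_W-/(_ k)[W [WI MW W0]]; exists W; split=> // l; rewrite inE => /andP[_].
  exact: W0.
- exact: IF.
Qed.

Lemma codeg0 k b : (b * codeg 0 k.+1 b = k.+1 * (k.+1 == b))%N.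
Proof.
rewrite /codeg; case: ltngtP => [bk|_|->]; rewrite ?muln0 ?subnn ?bin0 //.
by rewrite bin0n subn_eq0 leqNgt bk muln0.
Qed.

(** In degree [b i] the lift [W] of [M i] contains a new generator: inside [J + vmul (I k)] its
    image under [wedges (A i)] would be 0, since [J] is killed and vectors annihilate [M i]. *)
Lemma rank_remove n (I : nat -> 'M[K]_(edim n)) G A M b c k (J : 'M_(edim n)) i :
    resolved I G A M b c -> (J <= I k.+1)%MS ->
    {in G, forall j, J *m wedges (A j) = 0} -> i \in G -> c i = 0%N ->
  exists J1 : 'M_(edim n), [/\ (J1 <= I k.+1)%MS,
    {in G :\ i, forall j, J1 *m wedges (A j) = 0}
    & (\rank (J + vmul (I k)) + (k.+1 == b i) <= \rank (J1 + vmul (I k)))%N].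
Proof.
move=> [_ I_M I_W IF] JI J0 iG ci0.
have [bi|_] := eqVneq k.+1 (b i); last first.
  exists J; rewrite addn0; split=> // j; rewrite inE => /andP[_]; exact: J0.
have [W [WI MW W0]] := I_W i k.+1 iG.
have [Mv Mb0] : (forall k v, M i k *m wedge v = 0) /\ M i (b i) != 0.
  by have := IF i iG; rewrite ci0.
exists (J + W)%MS; split; first by rewrite addsmx_sub JI.
  move=> j; rewrite in_setD1 => /andP[ji jG]; apply/eqP; rewrite -submx0 addsmxMr.
  by rewrite addsmx_sub J0 // W0 // !sub0mx.
rewrite -[nat_of_bool true]/1%N addn1; apply: rank_ltmx; rewrite ltmxE addsmxS ?addsmxSl //=.
apply: contra Mb0 => subJ; rewrite -bi -submx0.
have {}subJ : (W <= J + vmul (I k))%MS.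
  by apply: submx_trans subJ; rewrite -addsmxA addsmxC -addsmxA addsmxSl.
apply: submx_trans MW _; apply: submx_trans (submxMr _ subJ) _.
rewrite addsmxMr addsmx_sub J0 // sub0mx /= submx0 -sub_kermx; apply: vmul_sub => v.
rewrite sub_kermx; apply/eqP; rewrite -mulmxA wedge_wedges -scalemxAr mulmxA.
have /submxP[y ->] := I_M i k iG.
by rewrite -mulmxA Mv mulmx0 scaler0.
Qed.

(** By [codeg0] the lost summand is [k.+1] if [k.+1 = b i] and 0 otherwise; the extra rank of [J1]
    pays for it. *)
Lemma growth_remove n (I : nat -> 'M[K]_(edim n)) G A M b c k (J : 'M_(edim n)) i :
    resolved I G A M b c -> (J <= I k.+1)%MS ->
    {in G, forall j, J *m wedges (A j) = 0} -> i \in G -> c i = 0%N ->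
    (forall J1 : 'M_(edim n), resolved I (G :\ i) A M b c -> (J1 <= I k.+1)%MS ->
       {in G :\ i, forall j, J1 *m wedges (A j) = 0} ->
     ((n - k) * \rank (I k) + \sum_(j in G :\ i) b j * codeg (c j) k.+1 (b j)
       + k.+1 * \rank (J1 + vmul (I k))%MS
     <= k.+1 * (\rank (I k.+1) + \rank (vmul (I k))))%N) ->
  ((n - k) * \rank (I k) + \sum_(j in G) b j * codeg (c j) k.+1 (b j)
     + k.+1 * \rank (J + vmul (I k))%MS
   <= k.+1 * (\rank (I k.+1) + \rank (vmul (I k))))%N.
Proof.
move=> IG JI J0 iG ci0 /[dup] IH.
have [J1 [J1I J10 rkJ1]] := rank_remove IG JI J0 iG ci0.
move/(_ J1 (resolved_setD1 i IG) J1I J10); apply: leq_trans.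
rewrite (big_setD1 i iG) /= ci0 codeg0.
have := leq_mul (leqnn k.+1) rkJ1; rewrite mulnDr.
by move: (_ * _)%N (\sum_(_ in _) _)%N (k.+1 * _)%N (k.+1 * _)%N (k.+1 * _)%N; lia.
Qed.

(** The estimate for I' at index [k] is added to the one for I'' at index [k - 1]; Pascal's rule
    recombines the binomials. *)
Lemma growth_step n (I : nat -> 'M[K]_(edim n + edim n)) G
    (A : T -> seq 'rV[K]_n.+1) M b c k (J : 'M_(edim n + edim n)) :
    (forall I A M c k (J : 'M_(edim n)), resolved I G A M b c -> (J <= I k.+1)%MS ->
     {in G, forall i, J *m wedges (A i) = 0} ->
     ((n - k) * \rank (I k) + \sum_(i in G) b i * codeg (c i) k.+1 (b i)
        + k.+1 * \rank (J + vmul (I k))%MS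
      <= k.+1 * (\rank (I k.+1) + \rank (vmul (I k))))%N) ->
    @resolved n.+1 I G A M b c -> {in G, forall i, (0 < c i)%N} ->
    (J <= I k.+1)%MS -> {in G, forall i, J *m wedges (A i) = 0} ->
  ((n.+1 - k) * \rank (I k) + \sum_(i in G) b i * codeg (c i) k.+1 (b i)
     + k.+1 * \rank (J + @vmul n.+1 (I k))%MS
   <= k.+1 * (\rank (I k.+1) + \rank (@vmul n.+1 (I k))))%N.
Proof.
move=> IHn IG c_gt0 JI J0.
have Ih := resolved_high IG c_gt0; have Il := resolved_low IG c_gt0.
have I_ideal : (@vmul n.+1 (I k) <= I k.+1)%MS by apply: vmul_sub; case: IG => [[]].
have hJ0 : {in G, forall i, high J *m wedges (tail (A i)) = 0}.
  move=> i iG; apply/eqP; rewrite -submx0 -high_wedges J0 //.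
  by rewrite genmxE linear0 sub0mx.
have {Ih}IH1 := IHn _ _ _ _ k (high J) Ih (highS JI) hJ0.
rewrite !mxrank_high_low.
set H := @vmul n.+1 (I k) in I_ideal *.
set Q := (J + H)%MS.
have QI : (Q <= I k.+1)%MS by rewrite addsmx_sub JI.
have rk1 : (\rank (high Q) + \rank (vmul (high (I k)))
            <= \rank (high J + vmul (high (I k)))%MS + \rank (high H))%N.
  have hQ : (high Q <= high J + high H)%MS.
    exact: high_adds.
  apply: leq_trans (mxrank_adds_mono _ (@vmul_high n (I k) H (submx_refl _))).
  by rewrite leq_add2r mxrankS.
have rk2 : (\rank (low Q) + \rank (high (I k)) <= \rank (low H) + \rank (low (I k.+1)))%N.
  rewrite addnC leq_add // mxrankS // ?lowS //.
  exact: (@high_low_vmul n).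
case: k IH1 {JI hJ0} @H @Q I_ideal QI rk1 rk2 => [|k] IH1 H Q I_ideal QI rk1 rk2.
  (* At [k = 0] there is no estimate for I'' to add, and none is needed: only indices with [b i = 1]
     contribute, and their terms do not depend on [c i]. *)
  have l0 : \rank (low (I 0)) = 0%N.
    case: (IG) => [[_ /(_ 0)/sub_diag_block[_ lowI]] _ _ _].
    by apply/eqP; rewrite mxrank_eq0 -submx0.
  have Sc : (\sum_(i in G) b i * codeg (c i) 1 (b i)
             <= \sum_(i in G) b i * codeg (c i).-1 1 (b i))%N.
    apply: leq_sum => i _; rewrite /codeg; case: (b i) => [|[|b']] //.
    by rewrite subnn !bin0.
  move: IH1 rk1 rk2 Sc; rewrite l0 !subn0 /=; lia.
(* Here the strengthening by [J] pays: [low Q] lies in [J' + low H], so the undetected generators of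
   I'' bound its excess over [low H]. *)
have [J' lI [J'I J'0]] := low_sub_killed IG c_gt0 k.+1.
have {Il}IH2 := IHn _ _ _ _ k J' Il J'I J'0.
have rk3 : (\rank (low Q) + \rank (vmul (low (I k.+1)))
            <= \rank (low H) + \rank (J' + vmul (low (I k.+1)))%MS)%N.
  rewrite [leqRHS]addnC.
  apply: leq_trans (mxrank_adds_mono _ (@vmul_low n (I k.+1) H (submx_refl _))).
  rewrite leq_add2r mxrankS //; apply: submx_trans (lowS QI) (submx_trans lI _).
  by rewrite addsmxS // (@high_low_vmul n).
have Sc : (\sum_(i in G) b i * codeg (c i) k.+2 (b i)
     = \sum_(i in G) b i * codeg (c i).-1 k.+2 (b i)
     + \sum_(i in G) b i * codeg (c i).-1 k.+1 (b i))%N.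
  rewrite -big_split /=; apply: eq_bigr => i /c_gt0; case: (c i) => // c' _ /=.
  rewrite -mulnDr; congr muln; exact: codegS.
rewrite Sc; rewrite subSS.
have dle : ((n - k) * \rank (high (I k.+1)) <=
  (n - k.+1) * \rank (high (I k.+1)) + \rank (high (I k.+1)))%N.
  by rewrite -mulSnr leq_mul2r; apply/orP; right; lia.
(* One copy of [rk2] completes the sum: it supplies the missing [\rank (high (I k.+1))] and raises
   the coefficient of [\rank (low (I k.+2))] from [k.+1] to [k.+2]. *)
have := leq_mul (leqnn k.+2) rk1; have := leq_mul (leqnn k.+1) rk3.
move: IH1 IH2 dle rk2; rewrite !mulnDr.
lia.
Qed.

(* The rank of J + vmul (I k) relative to vmul (I k) counts the generators of I in
   degree k + 1 that no wedges (A i), i in G, detects. *)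
Theorem growth n (I : nat -> 'M[K]_(edim n)) (G : {set T}) A M b c k (J : 'M_(edim n)) :
    resolved I G A M b c -> (J <= I k.+1)%MS ->
    {in G, forall i, J *m wedges (A i) = 0} ->
  ((n - k) * \rank (I k) + \sum_(i in G) b i * codeg (c i) k.+1 (b i)
     + k.+1 * \rank (J + vmul (I k))%MS
   <= k.+1 * (\rank (I k.+1) + \rank (vmul (I k))))%N.
Proof.
elim: n I G A M c k J => [|n IHn] I G; have [g] := ubnP #|G|.
(* Indices with [c i = 0] are removed by an inner induction on [#|G|]; once none is left, the first
   basis vector is split off. *)
all: elim: g G => // g IHg G ltGg A M c k J IG JI J0.
all: have [/existsP[i /andP[iG /eqP ci0]] | /existsPn cG] := boolP [exists i in G, c i == 0%N].
- apply: (growth_remove IG JI J0 iG ci0) => J1; apply: IHg.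
  by move: ltGg; rewrite (cardsD1 i) iG.
(* In dimension 0 [cofree] excludes positive codimension, so [G] is empty. *)
- rewrite big_pred0 => [|i]; last first.
    apply/negbTE/negP=> iG; have := cG i; rewrite iG /=.
    by case: IG => _ _ _ /(_ i iG); case: (c i).
  rewrite sub0n add0n leq_mul2l /= (leq_trans _ (leq_addr _ _)) // mxrankS //.
  by rewrite addsmx_sub JI; apply: (@vmul_sub 0); case: IG => [[]].
- apply: (growth_remove IG JI J0 iG ci0) => J1; apply: IHg.
  by move: ltGg; rewrite (cardsD1 i) iG.
apply: (growth_step _ IG) => //; first by move=> I1 A1 M1 c1 k1 J1 r1 r2 r3; apply: IHn r1 r2 r3.
by move=> i iG; have := cG i; rewrite iG lt0n.
Qed.

End Growth.

(** * Generic coordinates *)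

Section Generic.
Variable K : fieldType.

(* The ideal of the product of S, with degrees lowered by size S - b: it is the image
   under wedges A of the ideal of B when S = B ++ A and b = size B. *)
Definition shifted_ideal n (S : seq 'rV[K]_n) b k : 'M[K]_(edim n) :=
  if (b <= k)%N then grade K n (k - b) *m wedges S else 0.

(** The first [c] basis vectors are divided out one by one, each outside the span of the current
    images of [S]; in the last quotient [S] becomes a basis. *)
Fixpoint generic (c : nat) : forall n, seq 'rV[K]_n -> Prop :=
  match c return forall n, seq 'rV[K]_n -> Prop with
  | 0 => fun n S => \rank (spanmx S) = size S /\ size S = n
  | c'.+1 => fun n => match n return seq 'rV[K]_n -> Prop with
    | 0 => fun=> False
    | n'.+1 => fun S =>
        ~~ ((row_mx 1%:M 0 : 'rV_(1 + n')) <= spanmx S)%MS /\ generic c' (tail S)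
    end
  end.

Lemma cofree_eqmx c n b (M1 M2 : nat -> 'M[K]_(edim n)) :
  (forall k, (M1 k :=: M2 k)%MS) -> cofree c b M1 -> cofree c b M2.
Proof.
elim: c n M1 M2 => [|c IHc] [|n] M1 M2 eqM //=.
- case=> M1v M1b; split; last by rewrite -submx0 -eqM submx0.
  by move=> k v; apply/eqP; rewrite mulmx0.
- case=> M1v M1b; split; last by rewrite -submx0 -eqM submx0.
  by move=> k v; apply/eqP; rewrite -submx0 -(eqmxMr _ (eqM k)) submx0; apply/eqP/M1v.
have hE k : (high (M1 k : 'M_(edim n + edim n)) :=: high (M2 k : 'M_(edim n + edim n)))%MS.
  by apply/eqmxP/andP; split; apply: highS; rewrite eqM.
case=> /(IHc _ _ _ hE) ? M1l; split=> // k.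
by rewrite -hE; apply: submx_trans (M1l k); apply: lowS; rewrite eqM.
Qed.

Lemma high_shifted_ideal n (S : seq 'rV[K]_n.+1) b k :
  (high (shifted_ideal S b k : 'M_(edim n + edim n)) :=: shifted_ideal (tail S) b k)%MS.
Proof.
rewrite /shifted_ideal; case: ifP => _; last first.
  by apply: eqmx_trans (genmxE _) _; rewrite linear0; apply/eqmxP; rewrite !sub0mx.
apply: eqmx_trans (high_wedges _ _) (eqmxMr _ _).
apply: eqmx_trans (genmxE _) _ => /=.
rewrite block_mxEh row_mxKl.
apply/eqmxP; rewrite -addsmxE addsmx_sub sub0mx submx_refl /=.
by rewrite -addsmxE addsmxSl.
Qed.

(** If [f] is 1 on [e] and 0 on [S], contraction by [f] recovers [y] modulo [e] from [e y], lowers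
    the degree by one and preserves the ideal of the product of [S]. *)
Lemma low_shifted_ideal n (S : seq 'rV[K]_n.+1) b k :
    ~~ ((row_mx 1%:M 0 : 'rV_(1 + n)) <= spanmx S)%MS ->
  (low (shifted_ideal S b k.+1 : 'M_(edim n + edim n))
     <= high (shifted_ideal S b k : 'M_(edim n + edim n)))%MS.
Proof.
case/functional_notin=> f Sf e1f.
set X := low _; have X_sub : (row_mx 0 X <= shifted_ideal S b k.+1)%MS.
  exact: row0_low.
have we1 r (Z : 'M[K]_(r, edim n + edim n)) :
    Z *m wedge (row_mx 1%:M 0 : 'rV_(1 + n)) = row_mx 0 (lsubmx Z).
  rewrite /= row_mxKr row_mxKl raddf0 /= oppr0 mxE eqxx mulr1n.
  rewrite -{1}(hsubmxK Z).
  by rewrite mul_row_block !mulmx0 mulmx1 !addr0.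
have X0 : row_mx 0 X *m wedge (row_mx 1%:M 0 : 'rV_(1 + n)) = 0.
  by rewrite we1 row_mxKl row_mx0.
have := wedge_contr (row_mx 1%:M 0 : 'rV_(1 + n)) f; rewrite e1f => D1.
have XE : row_mx 0 X = row_mx 0 X *m contr f *m wedge (row_mx 1%:M 0 : 'rV_(1 + n)).
  by rewrite -[LHS]mulmx1 -[1%:M]D1 mulmxDr !mulmxA X0 mul0mx add0r.
rewrite we1 in XE; have [_ ->] := eq_row_mx XE.
suff : (row_mx 0 X *m contr f <= shifted_ideal S b k)%MS by move/highS; rewrite genmxE.
apply: submx_trans (submxMr _ X_sub) _.
rewrite /shifted_ideal; case: (leqP b k.+1) => bk1; last by rewrite mul0mx sub0mx.
have Sf0 v : v \in S -> v *m f = 0.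
  by move=> vS; have := submxMr f (spanmx_sup vS); rewrite Sf => /submx0null.
have -> : grade K n.+1 (k.+1 - b) *m wedges S *m contr f =
    (-1) ^+ size S *: (grade K n.+1 (k.+1 - b) *m contr f *m wedges S).
  by rewrite -[in RHS]mulmxA contr_wedges // -scalemxAr scalerA -expr2 sqrr_sign scale1r mulmxA.
rewrite scalemx_sub //; case: leqP => bk.
  by rewrite subSn // grade_contr -mulmxA submxMl.
(* Here [b = k.+1]: the coefficients are scalars, which contraction kills. *)
have -> : (k.+1 - b)%N = 0%N by lia.
by rewrite grade0_contr mul0mx sub0mx.
Qed.

Lemma cofree_shifted_ideal c n (S : seq 'rV[K]_n) b :
  generic c S -> cofree c b (shifted_ideal S b).
Proof.
elim: c n S => [|c IHc] [|n] S //=.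
- case=> rkS sS; split; first by move=> k v; rewrite mulmx0.
  by rewrite /shifted_ideal leqnn subnn; apply: (@grade0_wedges_neq0 _ 0).
- case=> rkS sS; split; last first.
    by rewrite /shifted_ideal leqnn subnn; apply: (@grade0_wedges_neq0 _ n.+1).
  move=> k v; rewrite /shifted_ideal; case: ifP => _; last exact: mul0mx.
  rewrite -mulmxA wedges_sum_span ?mulmx0 //; apply: submx_full.
  by rewrite /row_full -/(spanmx S) rkS sS.
case=> e1S gS; split; last by move=> k; apply: low_shifted_ideal.
apply: cofree_eqmx (IHc _ _ gS) => k.
exact: eqmx_sym (high_shifted_ideal _ _ _).
Qed.

(** * Existence of generic coordinates *)

Lemma spanmx_map n p (S : seq 'rV[K]_n) (g : 'M_(n, p)) :
  (spanmx [seq v *m g | v <- S] :=: spanmx S *m g)%MS.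
Proof.
elim: S => [|v S IH] /=; first by rewrite /spanmx !big_nil mul0mx; apply/eqmxP; rewrite !sub0mx.
rewrite !spanmx_cons; apply: eqmx_trans (eqmx_sym (addsmxMr _ _ _)).
by apply: adds_eqmx IH; apply: eqmx_trans (genmxE _) (eqmx_sym (eqmxMr _ (genmxE _))).
Qed.

(** Stated through polynomials because avoiding finitely many proper subspaces reduces to avoiding
    the roots of one product. *)
Definition infinite_field := forall p : {poly K}, p != 0 -> exists t, ~~ root p t.

Lemma avoid_subspaces (T : finType) n (U : T -> 'M[K]_n.+1) : infinite_field ->
  exists2 x : 'rV[K]_n.+1, x != 0 &
    forall i, (\rank (U i) < n.+1)%N -> ~~ (x <= U i)%MS.
Proof.
(* On the moment curve a nonzero functional becomes a nonzero polynomial in [t]. *)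
move=> Kinf; pose x t : 'rV[K]_n.+1 := \row_j t ^+ j.
have exp i : exists p : {poly K}, p != 0 /\
    ((\rank (U i) < n.+1)%N -> forall t, ~~ root p t -> ~~ (x t <= U i)%MS).
  have [ltU|_] := boolP (\rank (U i) < n.+1)%N; last by exists 1; rewrite oner_neq0.
  have /row_subPn[j /functional_notin[f Uf ef]] : ~~ ((1%:M : 'M_n.+1) <= U i)%MS.
    by rewrite sub1mx /row_full neq_ltn ltU.
  pose p := \poly_(l < n.+1) f (inord l) 0.
  have pf t : (x t *m f) 0 0 = p.[t].
    rewrite horner_poly mxE; apply: eq_bigr => l _.
    by rewrite inord_val !mxE mulrC.
  exists p; split.
    apply/eqP=> p0; move: ef; rewrite row1 -rowE mxE => fj.
    have := coef_poly n.+1 (fun l => f (inord l) 0) j.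
    by rewrite -/p p0 coef0 ltn_ord inord_val fj => /eqP; rewrite eq_sym oner_eq0.
  move=> _ t; apply: contraNN => /(submxMr f); rewrite Uf => /submx0null xf.
  by rewrite rootE -pf xf mxE.
have [p pP] := fin_all_exists exp.
have [t] : exists t, ~~ root (\prod_i p i) t.
  by apply: Kinf; apply/prodf_neq0 => i _; case: (pP i).
rewrite rootE horner_prod => /prodf_neq0 pt; exists (x t).
  by apply/eqP=> /rowP/(_ 0)/eqP; rewrite !mxE expr0 oner_eq0.
by move=> i ltU; apply: (pP i).2 => //; apply: pt.
Qed.

Lemma exists_unit_e1 n (x : 'rV[K]_(1 + n)) : x != 0 ->
  exists2 g : 'M[K]_(1 + n), g \in unitmx & x *m g = row_mx 1%:M 0.
Proof.
move=> x0; pose v := \row_j (if unlift 0 j is Some _ then 0 else 1) : 'rV[K]_(1 + n).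
have rkx : \rank x = 1%N by rewrite rank_rV x0.
(* Gaussian elimination writes [x] as a scalar [c] times the first row of [r]. *)
have := mulmx_ebase x; rewrite rkx; set c := col_ebase x; set r := row_ebase x => cr.
have c0 : c 0 0 != 0.
  by have := col_ebase_unit x; rewrite -/c unitmxE unitfE det_mx11.
exists ((c 0 0)^-1 *: invmx r).
  by rewrite unitmxZ ?unitfE ?invr_eq0 // unitmx_inv row_ebase_unit.
rewrite -scalemxAr -cr mulmxK ?row_ebase_unit // pid_mx_row.
by rewrite [c]mx11_scalar mul_scalar_mx scalerA mxE eqxx mulr1n mulVf // scale1r.
Qed.

Definition drop1 n : 'M[K]_(1 + n, n) := col_mx 0 1%:M.

Lemma mul_drop1 n r (v : 'M[K]_(r, 1 + n)) : v *m drop1 n = rsubmx v.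
Proof. by rewrite -{1}(hsubmxK v) mul_row_col mulmx0 mulmx1 add0r. Qed.

Lemma tail_drop1 n (S : seq 'rV[K]_n.+1) : tail S = [seq v *m drop1 n | v <- S].
Proof. by apply: eq_map => v; rewrite mul_drop1. Qed.

Lemma rank_spanmx_tail n (S : seq 'rV[K]_n.+1) :
  ~~ ((row_mx 1%:M 0 : 'rV_(1 + n)) <= spanmx S)%MS ->
  \rank (spanmx (tail S)) = \rank (spanmx S).
Proof.
move=> e1S; rewrite tail_drop1 spanmx_map -[RHS](mxrank_mul_ker _ (drop1 n)).
suff -> : (spanmx S :&: kermx (drop1 n))%MS = 0 by rewrite mxrank0 addn0.
apply/eqP; apply: contraNT e1S => /rowV0Pn[v]; rewrite sub_capmx sub_kermx mul_drop1.
case/andP=> vS /eqP v0 v_neq0.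
have a0 : lsubmx (v : 'rV_(1 + n)) 0 0 != 0.
  apply: contraNneq v_neq0 => a0; rewrite -(hsubmxK (v : 'rV_(1 + n))) v0.
  by rewrite [lsubmx _]mx11_scalar a0 raddf0 row_mx0.
have vE : v = lsubmx (v : 'rV_(1 + n)) 0 0 *: (row_mx 1%:M 0 : 'rV_(1 + n)).
  rewrite -{1}(hsubmxK (v : 'rV_(1 + n))) v0 scale_row_mx scaler0 scalemx1.
  by rewrite {1}[lsubmx _]mx11_scalar.
by move: vS; rewrite vE eqmx_scale.
Qed.

Lemma exists_generic (T : finType) n (S : T -> seq 'rV[K]_n) : infinite_field ->
  (forall i, \rank (spanmx (S i)) = size (S i)) ->
  exists2 g : 'M[K]_n, g \in unitmx &
    forall i, generic (n - size (S i)) [seq v *m g | v <- S i].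
Proof.
move=> Kinf; elim: n S => [|n IHn] S rkS.
  exists 1%:M => [|i]; first exact: unitmx1.
  have S0 : size (S i) = 0%N.
    by apply/eqP; rewrite -leqn0 -rkS rank_leq_col.
  by case: (S i) S0 => //= _; rewrite /spanmx big_nil mxrank0.
have [x x0 xS] := avoid_subspaces (fun i => spanmx (S i)) Kinf.
have [g0 g0u xg0] := @exists_unit_e1 n x x0.
(* A family spanning the whole space imposes no further condition; the empty family stands in for
   it, being independent. *)
pose S1 i := if (size (S i) < n.+1)%N then tail [seq v *m g0 | v <- S i] else [::].
have e1S i (g : 'M[K]_n.+1) : (size (S i) < n.+1)%N -> g \in unitmx ->
    x *m g = row_mx 1%:M 0 :> 'rV_(1 + n) ->
    ~~ ((row_mx 1%:M 0 : 'rV_(1 + n)) <= spanmx [seq v *m g | v <- S i])%MS.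
  move=> ltS gu <-; rewrite spanmx_map submxMfree ?row_free_unit //.
  by apply: xS; rewrite rkS.
have rkg i (g : 'M[K]_n.+1) : g \in unitmx ->
    \rank (spanmx [seq v *m g | v <- S i]) = size (S i).
  by move=> gu; rewrite spanmx_map mxrankMfree ?row_free_unit.
have rkS1 i : \rank (spanmx (S1 i)) = size (S1 i).
  rewrite /S1; case: ifP => [ltS|_]; last by rewrite /spanmx big_nil mxrank0.
  by rewrite rank_spanmx_tail ?e1S // rkg // !size_map.
have [g1 g1u gen1] := IHn S1 rkS1.
(* [h] fixes the first basis vector and acts by [g1] modulo it, so the avoidance already achieved
   survives. *)
pose h : 'M[K]_(1 + n) := block_mx 1%:M 0 0 g1.
have hu : h \in unitmx by rewrite unitmxE det_ublock det1 mul1r -unitmxE.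
have xgh : x *m (g0 *m h) = row_mx 1%:M 0 :> 'rV_(1 + n).
  by rewrite mulmxA xg0 mul_row_block !mulmx0 !mul0mx !addr0 mulmx1.
have ghu : g0 *m h \in unitmx by rewrite unitmx_mul g0u.
exists (g0 *m h) => // i.
have [ltS|leS] := ltnP (size (S i)) n.+1; last first.
  have sS : size (S i) = n.+1.
    by apply/eqP; rewrite eqn_leq leS -rkS rank_leq_col.
  by rewrite sS subnn /= rkg // size_map sS.
rewrite subSn //=; split; first exact: e1S.
have := gen1 i; rewrite /S1 ltS !size_map.
suff -> : [seq v *m g1 | v <- tail [seq v *m g0 | v <- S i]] =
          tail [seq v *m (g0 *m h) | v <- S i] by [].
rewrite /tail -!map_comp; apply: eq_map => v /=; rewrite mulmxA.
set w := v *m g0; rewrite -{2}(hsubmxK (w : 'rV_(1 + n))).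
by rewrite mul_row_block row_mxKr mulmx0 add0r.
Qed.

End Generic.

(** * Set-pair systems over an infinite field *)

Section SetPairs.
Variable K : fieldType.

(** The identity [wedge x *m contr f + contr f *m wedge x], with [f] equal to 1 on [x], is inserted
    between the factors; each term then multiplies [x] with a family whose span contains it. *)
Lemma wedges_meet n (A B : seq 'rV[K]_n) (x : 'rV[K]_n) :
  x != 0 -> (x <= spanmx A)%MS -> (x <= spanmx B)%MS -> wedges A *m wedges B = 0.
Proof.
move=> x0 xA xB; have : ~~ (x <= (0 : 'M_n))%MS by rewrite submx0.
case/functional_notin=> f _ xf; have := wedge_contr x f; rewrite xf => D1.
have xB0 : wedge x *m wedges B = 0.
  by rewrite wedge_wedges wedges_sum_span // scaler0.
rewrite -[wedges B]mul1mx -D1 mulmxDl -!mulmxA xB0 mulmx0 addr0.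
by rewrite !mulmxA wedges_sum_span // !mul0mx.
Qed.

Section Ideal.
Variables (m n : nat) (A B : 'I_m -> seq 'rV[K]_n).
Hypothesis meet : forall i j, i != j ->
  exists2 x : 'rV[K]_n, x != 0 & (x <= spanmx (A i))%MS /\ (x <= spanmx (B j))%MS.
Hypothesis gen : forall i, generic (n - size (B i ++ A i)) (B i ++ A i).

Let b i := size (B i).
Let I k : 'M[K]_(edim n) := (\sum_i shifted_ideal (B i) (b i) k)%MS.

Lemma resolved_ideal : resolved I [set: 'I_m] A
  (fun i => shifted_ideal (B i ++ A i) (b i)) b (fun i => n - size (B i ++ A i))%N.
Proof.
have AB i k : shifted_ideal (B i) (b i) k *m wedges (A i) = shifted_ideal (B i ++ A i) (b i) k.
  by rewrite /shifted_ideal; case: ifP => _; rewrite ?mul0mx // wedges_cat mulmxA.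
have AB0 i j k : j != i -> shifted_ideal (B i) (b i) k *m wedges (A j) = 0.
  move=> /meet[x x0 [xA xB]]; rewrite /shifted_ideal; case: ifP => _; rewrite ?mul0mx //.
  by rewrite -mulmxA (wedges_meet x0 xB xA) mulmx0.
split=> [|i k _|i k _|i _].
- split=> [k v|k].
    rewrite sumsmxMr; apply/sumsmx_subP => i _.
    apply: submx_trans (sumsmx_sup i _ (submx_refl _)) => //.
    rewrite /shifted_ideal; case: leqP => bk; last by rewrite mul0mx sub0mx.
    rewrite leqW // subSn // -mulmxA -[_ *m wedge v]scale1r.
    have <- : (-1) ^+ size (B i) * (-1) ^+ size (B i) = 1 :> K by rewrite -expr2 sqrr_sign.
    rewrite -scalerA -wedge_wedges -scalemxAr scalemx_sub // mulmxA grade_wedge.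
    by rewrite -mulmxA submxMl.
  apply/sumsmx_subP => i _; rewrite /shifted_ideal; case: leqP => bk; last exact: sub0mx.
  by rewrite grade_wedges subnK // submxMl.
- rewrite sumsmxMr; apply/sumsmx_subP => j _.
  have [->|ji] := eqVneq j i; first by rewrite AB.
  by rewrite AB0 ?sub0mx // eq_sym.
(* The summand of index [i] is the lift, since every other [wedges (A j)] kills it. *)
- exists (shifted_ideal (B i) (b i) k); split; first exact: (sumsmx_sup i).
    by rewrite AB.
  by move=> j _; apply: AB0.
exact: cofree_shifted_ideal.
Qed.

Lemma growth_ideal k :
  ((n - k) * \rank (I k) + \sum_i b i * codeg (n - size (B i ++ A i)) k.+1 (b i)
   <= k.+1 * \rank (I k.+1))%N.
Proof.
(* With [J = 0] the rank of [vmul (I k)] cancels. *)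
have := growth resolved_ideal (sub0mx _ (I k.+1)) (fun i _ => mul0mx _ (wedges (A i))).
rewrite adds0mx mulnDr leq_add2r; apply: leq_trans; rewrite leq_add2l.
by apply: eq_leq; apply: eq_bigl => i; rewrite inE.
Qed.

Hypothesis b_gt0 : forall i, (0 < b i)%N.

Lemma rank_ideal0 : \rank (I 0) = 0%N.
Proof.
rewrite /I big1 ?mxrank0 // => i _.
by rewrite /shifted_ideal leqNgt b_gt0.
Qed.

Lemma rank_ideal_top : (\rank (I n) <= 1)%N.
Proof.
have [[_ /(_ n)/mxrankS leI] _ _ _] := resolved_ideal.
by apply: leq_trans leI (leq_trans (rank_grade_top _ (leqnn n)) _); rewrite eqxx.
Qed.

(** Since [k.+1 * 'C(n, k.+1) = (n - k) * 'C(n, k)], dividing [growth_ideal] by it bounds each term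
    by an increment of [\rank (I k) / 'C(n, k)]. *)
Lemma sum_growth_le : \sum_(k < n) \sum_i
  (b i * codeg (n - size (B i ++ A i)) k.+1 (b i))%:R / (k.+1%:R * 'C(n, k.+1)%:R) <= 1 :> rat.
Proof.
suff tele j : (j <= n)%N -> \sum_(k < j) \sum_i
    (b i * codeg (n - size (B i ++ A i)) k.+1 (b i))%:R / (k.+1%:R * 'C(n, k.+1)%:R)
    <= (\rank (I j))%:R / 'C(n, j)%:R :> rat.
  apply: le_trans (tele n (leqnn n)) _.
  by rewrite binn divr1 lern1 rank_ideal_top.
elim: j => [_|j IHj ltjn]; first by rewrite big_ord0 rank_ideal0 mul0r.
rewrite big_ord_recr /=; apply: le_trans (lerD (IHj (ltnW ltjn)) (lexx _)) _.
have Cj : 0 < 'C(n, j)%:R :> rat by rewrite ltr0n bin_gt0 ltnW.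
have Cj1 : 0 < 'C(n, j.+1)%:R :> rat by rewrite ltr0n bin_gt0.
have Ej : j.+1%:R * 'C(n, j.+1)%:R = (n - j)%:R * 'C(n, j)%:R :> rat.
  by rewrite -!natrM mul_bin_left.
rewrite -mulr_suml -natr_sum.
have -> : (\rank (I j))%:R / 'C(n, j)%:R =
    ((n - j) * \rank (I j))%:R / (j.+1%:R * 'C(n, j.+1)%:R) :> rat.
  by rewrite Ej natrM -mulf_div divff ?mul1r // pnatr_eq0 subn_eq0 -ltnNge.
rewrite -mulrDl -natrD.
apply: le_trans (_ : (j.+1 * \rank (I j.+1))%:R / (j.+1%:R * 'C(n, j.+1)%:R) <= _).
  by rewrite ler_wpM2r ?invr_ge0 ?mulr_ge0 // ler_nat growth_ideal.
by rewrite natrM -mulf_div divff ?pnatr_eq0 // mul1r.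
Qed.

End Ideal.
End SetPairs.

(** * Summation of the binomial weights *)

(** The right side is the Beta integral of [x^(k-1) (1-x)^(n-k)] over [0,1]; the identity reflects
    [(1-x) + x = 1]. *)
Lemma bin_beta n k : (0 < k <= n)%N ->
  (k%:R * 'C(n.+1, k)%:R)^-1 + (k.+1%:R * 'C(n.+1, k.+1)%:R)^-1 = (k%:R * 'C(n, k)%:R)^-1 :> rat.
Proof.
case/andP=> k_gt0 lekn.
have x0 : 'C(n, k)%:R != 0 :> rat by rewrite pnatr_eq0 -lt0n bin_gt0.
have n0 : n.+1%:R != 0 :> rat by rewrite pnatr_eq0.
have k0 : k%:R != 0 :> rat by rewrite pnatr_eq0 -lt0n.
have d0 : n.+1%:R - k%:R != 0 :> rat.
  by rewrite -natrB ?pnatr_eq0 ?subn_eq0 -?ltnNge // leqW.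
have E2 : k.+1%:R * 'C(n.+1, k.+1)%:R = n.+1%:R * 'C(n, k)%:R :> rat.
  by rewrite -!natrM -mul_bin_diag.
have E1 : 'C(n.+1, k)%:R = n.+1%:R * 'C(n, k)%:R / (n.+1%:R - k%:R) :> rat.
  apply: (mulIf d0); rewrite mulfVK // -natrB ?leqW // -!natrM.
  by rewrite mul_bin_down mulnC.
rewrite E2 E1; move: n0 k0 x0 d0; rewrite -natr1.
move: (n%:R) (k%:R) ('C(n, k)%:R) => x y z x0 y0 z0 d0; field.
by rewrite x0 y0 z0 d0.
Qed.

(** Under the Beta integral this is [x^(b-1) (1-x)^(s-b)] times the expansion of [(x + (1-x))^c], so
    the value does not depend on [c]. *)
Lemma sum_codeg_beta s c b : (0 < b <= s)%N ->
  \sum_(k < s + c) (codeg c k.+1 b)%:R / (k.+1%:R * 'C(s + c, k.+1)%:R)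
    = (b%:R * 'C(s, b)%:R)^-1 :> rat.
Proof.
case/andP=> b_gt0 lebs; elim: c => [|c IHc].
  rewrite addn0; case: b b_gt0 lebs => // b _ ltbs.
  rewrite (bigD1 (Ordinal ltbs)) //= big1 ?addr0 => [|k kb].
    by rewrite /codeg leqnn subnn mul1r.
  suff -> : codeg 0 k.+1 b.+1 = 0%N by rewrite mul0r.
  rewrite /codeg; case: ifP => // lebk.
  rewrite bin0n subn_eq0 leqNgt ltn_neqAle lebk andbT.
  by rewrite eqSS eq_sym [_ == _](negbTE kb).
rewrite -IHc addnS.
under eq_bigr => k _ do rewrite codegS natrD mulrDl.
rewrite big_split /= big_ord_recr /= big_ord_recl /=.
have -> : codeg c (s + c).+1 b = 0%N.
  by rewrite /codeg; case: leqP => // _; rewrite bin_small //; lia.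
have -> : codeg c 0 b = 0%N by rewrite /codeg leqNgt b_gt0.
rewrite !mul0r addr0 add0r -big_split /=; apply: eq_bigr => k _.
by rewrite -mulrDr bin_beta //= ltn_ord.
Qed.

Theorem set_pairs_infinite (K : fieldType) m n (A B : 'I_m -> seq 'rV[K]_n) :
    infinite_field K ->
    (forall i, \rank (spanmx (B i ++ A i)) = size (B i ++ A i)) ->
    (forall i, 0 < size (B i))%N ->
    (forall i j, i != j ->
      exists2 x : 'rV[K]_n, x != 0 & (x <= spanmx (A i))%MS /\ (x <= spanmx (B j))%MS) ->
  \sum_(i < m) ('C(size (A i) + size (B i), size (A i))%:R : rat)^-1 <= 1.
Proof.
move=> Kinf rkAB B_gt0 meet.
have [g gu gen] := exists_generic Kinf rkAB.
pose A' i := [seq v *m g | v <- A i]; pose B' i := [seq v *m g | v <- B i].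
have meet' i j : i != j -> exists2 x : 'rV[K]_n, x != 0 &
    (x <= spanmx (A' i))%MS /\ (x <= spanmx (B' j))%MS.
  case/meet=> x x0 [xA xB]; exists (x *m g).
    by apply: contraNneq x0 => xg0; rewrite -(mulmxK gu x) xg0 mul0mx.
  by rewrite !spanmx_map !submxMr.
have gen' i : generic (n - size (B' i ++ A' i)) (B' i ++ A' i).
  by rewrite -map_cat size_map.
have B'_gt0 i : (0 < size (B' i))%N by rewrite size_map.
apply: le_trans (sum_growth_le meet' gen' B'_gt0).
rewrite exchange_big /=; apply: ler_sum => i _.
rewrite -map_cat !size_map size_cat addnC.
have les : (size (B i) + size (A i) <= n)%N by rewrite -size_cat -rkAB rank_leq_col.
have bs : (0 < size (B i) <= size (B i) + size (A i))%N by rewrite B_gt0 leq_addr.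
(* Here the ambient dimension [n] drops out. *)
have := @sum_codeg_beta _ (n - (size (B i) + size (A i))) _ bs.
rewrite subnKC // => sumE.
under eq_bigr => k _ do rewrite natrM -mulrA.
rewrite -mulr_sumr sumE invfM mulrA divff ?mul1r ?pnatr_eq0 -?lt0n //.
by rewrite -(bin_sub (leq_addr _ _)) addKn.
Qed.

(** * Extension of scalars *)

(** The powers of the indeterminate are distinct, so they outnumber the roots of any nonzero
    polynomial. *)
Lemma infinite_fraction (F : fieldType) : infinite_field {fraction {poly F}}.
Proof.
move=> p p0; pose t j : {fraction {poly F}} := FracField.tofrac ('X^j : {poly F}).
have t_inj : injective t.
  move=> j l /eqP; rewrite tofrac_eq => /eqP/(congr1 (fun q : {poly F} => size q)).
  by rewrite !size_polyXn => -[].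
have : ~~ all (root p) (mkseq t (size p)).
  apply/negP=> /(max_poly_roots p0); rewrite mkseq_uniq // => /(_ isT).
  by rewrite size_mkseq ltnn.
by rewrite -has_predC => /hasP[x _ px]; exists x.
Qed.

Definition row_seq (K : fieldType) r n (M : 'M[K]_(r, n)) : seq 'rV[K]_n :=
  [seq row j M | j <- enum 'I_r].

Lemma size_row_seq (K : fieldType) r n (M : 'M[K]_(r, n)) : size (row_seq M) = r.
Proof. by rewrite size_map size_enum_ord. Qed.

Lemma spanmx_row_seq (K : fieldType) r n (M : 'M[K]_(r, n)) : (spanmx (row_seq M) :=: M)%MS.
Proof.
apply/eqmxP/andP; split.
  by apply: spanmx_sub => v /mapP[j _ ->]; apply: row_sub.
by apply/row_subP => j; apply/spanmx_sup/map_f; rewrite mem_enum.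
Qed.

Lemma spanmx_cat (K : fieldType) n (S1 S2 : seq 'rV[K]_n) :
  (spanmx (S1 ++ S2) :=: spanmx S1 + spanmx S2)%MS.
Proof.
elim: S1 => [|v S1 IH] /=.
  by apply: eqmx_sym; rewrite {1}/spanmx big_nil; apply: adds0mx.
rewrite !spanmx_cons -addsmxA; exact: adds_eqmx (eqmx_refl _) IH.
Qed.

Lemma dim_capv_mx (F : fieldType) (V : vectType F) (U W : {vspace V}) :
  \dim (U :&: W) = \rank (VectorInternalTheory.vs2mx U :&: VectorInternalTheory.vs2mx W)%MS.
Proof. by rewrite /dimv VectorInternalTheory.mx2vsK. Qed.

Theorem proposition4p2 (F : fieldType) (V : vectType F) (m : nat)
    (A B : 'I_m -> {vspace V})
    (A_neq0 : forall i : 'I_m, A i <> 0%VS)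
    (B_neq0 : forall i : 'I_m, B i <> 0%VS)
    (AB_diag : forall i : 'I_m, (A i :&: B i)%VS = 0%VS)
    (AB_off : forall i j : 'I_m, i <> j -> (A i :&: B j)%VS <> 0%VS) :
  \sum_(i < m) ('C(\dim (A i) + \dim (B i), \dim (A i))%:R : rat)^-1 <= 1.
Proof.
(* Scalars are extended to rational functions; [map_mx f] preserves ranks, sums and inclusions. *)
pose f : {rmorphism F -> {fraction {poly F}}} := @FracField.tofrac {poly F} \o polyC.
(* [row_base] gives a basis, so the list has length [\dim U]. *)
pose lift U := row_seq (map_mx f (row_base (VectorInternalTheory.vs2mx U))) : seq 'rV_(dim V).
have size_lift U : size (lift U) = \dim U by rewrite size_row_seq.
have span_lift U : (spanmx (lift U) :=: map_mx f (VectorInternalTheory.vs2mx U))%MS.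
  apply: eqmx_trans (spanmx_row_seq _) _.
  by apply/map_eqmx; apply: eq_row_base.
have := @set_pairs_infinite _ m _ (fun i => lift (A i)) (fun i => lift (B i))
  (@infinite_fraction F).
under eq_bigr => i _ do rewrite !size_lift.
apply.
- move=> i; rewrite spanmx_cat (adds_eqmx (span_lift _) (span_lift _)) -map_addsmx mxrank_map.
  rewrite size_cat !size_lift.
  rewrite mxrank_disjoint_sum //; apply/eqP; rewrite -mxrank_eq0 capmxC -dim_capv_mx.
  by rewrite AB_diag dimv0.
- by move=> i; rewrite size_lift lt0n dimv_eq0; apply/eqP.
move=> i j /eqP/AB_off/eqP; rewrite -dimv_eq0 dim_capv_mx mxrank_eq0.
case/rowV0Pn=> x; rewrite sub_capmx => /andP[xA xB] x0.
exists (map_mx f x); first by rewrite map_mx_eq0.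
by rewrite !span_lift !map_submx.
Qed.
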